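(* Let $(M,g)$ be an $n$-dimensional Riemannian manifold without boundary, $n\geq 3$. Assume that coordinates $(x^1,\ldots,x^n)$ on an open subset of $M$ are isothermal in the sense that $g_{ab}(x)=c(x)\,\delta_{ab}$ holds in these coordinates for some positive function $c\in C^r$, $r>2$. Then $(x^1,\ldots,x^n)$ are conformal harmonic coordinates.
   Context: $L_g=\Delta_g+\frac{n-2}{4(n-1)}R(g)$, where $\Delta_gu=-|g|^{-1/2}\partial_a(|g|^{1/2}g^{ab}\partial_bu)$, $|g|=\det(g_{ab})$, and $R(g)$ is the scalar curvature. Conformal harmonic coordinates on an open set $\Omega$: coordinates $(Z^1,\ldots,Z^n)$ on $\Omega$ such that $Z^k=f^k/f$, $k=1,\ldots,n$, for some $C^2$ functions $f^k$ and $f>0$ on $\Omega$ with $L_gf^k=L_gf=0$ on $\Omega$. *)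

(* Defs.v *)
From mathcomp Require Import all_boot all_order all_algebra.
From mathcomp Require Import all_classical all_reals all_analysis.

Set Implicit Arguments.
Unset Strict Implicit.
Unset Printing Implicit Defensive.

Import Order.TTheory GRing.Theory Num.Theory.
Import numFieldNormedType.Exports.

Local Open Scope classical_set_scope.
Local Open Scope ring_scope.

(** * Partial derivatives and the classes C^k, C^r on open subsets of R^n *)

Definition partial (R : realType) (n : nat) (a : 'I_n) (f : 'rV[R]_n -> R) :
    'rV[R]_n -> R :=
  fun z => 'D_(delta_mx 0 a) f z.

Definition partials (R : realType) (n : nat) (s : seq 'I_n)
    (f : 'rV[R]_n -> R) : 'rV[R]_n -> R :=
  foldr (@partial R n) f s.

(** All iterated partial derivatives of order at most [k] exist and are
    continuous on [V]; meant for open [V].  Existence is stated separately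
    because ['D_v f z] is a total operation. *)
Definition class_Ck (R : realType) (n : nat) (k : nat) (V : set 'rV[R]_n)
    (f : 'rV[R]_n -> R) : Prop :=
  (forall s i z, (size s < k)%N -> V z ->
     derivable (partials s f) z (delta_mx 0 i)) /\
  (forall s z, (size s <= k)%N -> V z -> {for z, continuous (partials s f)}).

Definition locally_holder (R : realType) (n : nat) (alpha : R)
    (V : set 'rV[R]_n) (f : 'rV[R]_n -> R) : Prop :=
  forall z, V z -> exists C e : R, 0 < e /\
    forall u v, V u -> V v -> ball z e u -> ball z e v ->
      `|f u - f v| <= C * `|u - v| `^ alpha.

(** [C^r = C^{k, alpha}] with [k] the integer part of [r] and [alpha = r - k],
    the Holder condition being local.  When [r = k] is an integer, [alpha = 0]
    and the Holder condition follows from continuity, so this is the usual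
    [C^k]. *)
Definition class_Cr (R : realType) (n : nat) (r : R) (V : set 'rV[R]_n)
    (f : 'rV[R]_n -> R) : Prop :=
  class_Ck (Num.truncn r) V f /\
  forall s, size s = Num.truncn r ->
    locally_holder (r - (Num.truncn r)%:R) V (partials s f).

(** * Manifolds without boundary, coordinates, Riemannian metrics *)

(** A homeomorphism from an open subset of [M] onto an open subset of R^n;
    the values of [coord] and [coord_inv] outside these sets are irrelevant. *)
Record coord_system (R : realType) (n : nat) (M : topologicalType) :=
  CoordSystem {
  cdom : set M ;
  coord : M -> 'rV[R]_n ;
  coord_inv : 'rV[R]_n -> M ;
  cdom_open : open cdom ;
  crange_open : open (coord @` cdom) ;
  coord_continuous : forall p, cdom p -> {for p, continuous coord} ;
  coord_inv_continuous :
    forall z, (coord @` cdom) z -> {for z, continuous coord_inv} ;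
  coordK : forall p, cdom p -> coord_inv (coord p) = p
}.

Definition crange (R : realType) (n : nat) (M : topologicalType)
    (x : coord_system R n M) : set 'rV[R]_n :=
  coord x @` cdom x.

Definition transition (R : realType) (n : nat) (M : topologicalType)
    (x y : coord_system R n M) (i : 'I_n) : 'rV[R]_n -> R :=
  fun z => coord y (coord_inv x z) 0 i.

Definition transition_Ck (R : realType) (n : nat) (M : topologicalType)
    (k : nat) (x y : coord_system R n M) : Prop :=
  forall i, class_Ck k (coord x @` (cdom x `&` cdom y)) (transition x y i).

Record smooth_structure (R : realType) (n : nat) (M : topologicalType) :=
  SmoothStructure {
  manifold_hausdorff : hausdorff_space M ;
  manifold_second_countable : @second_countable M ;
  atlas : set (coord_system R n M) ;
  atlas_cover : forall p : M, exists2 x, atlas x & cdom x p ;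
  atlas_smooth : forall x y, atlas x -> atlas y ->
    forall k, transition_Ck k x y
}.

(** Coordinates on an open subset of [M].  Only C^3 compatibility with the
    smooth structure is required: isothermal coordinates for a metric of finite
    regularity C^r are in general only C^{r+1}. *)
Definition coordinates (R : realType) (n : nat) (M : topologicalType)
    (S : smooth_structure R n M) (x : coord_system R n M) : Prop :=
  forall y, atlas S y -> transition_Ck 3 x y /\ transition_Ck 3 y x.

(** The matrix of partial derivatives [d y^i / d x^a] at [p]. *)
Definition jacobian_mx (R : realType) (n : nat) (M : topologicalType)
    (x y : coord_system R n M) (p : M) : 'M[R]_n :=
  \matrix_(a, i) partial a (transition x y i) (coord x p).

(** A (continuous) Riemannian metric, given as a covariant 2-tensor by its
    components [g_ab] in every system of coordinates. *)
Record riemannian_metric (R : realType) (n : nat) (M : topologicalType)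
    (S : smooth_structure R n M) := RiemannianMetric {
  gcomp : coord_system R n M -> M -> 'M[R]_n ;
  gcomp_sym : forall x p, coordinates S x -> cdom x p ->
    (gcomp x p)^T = gcomp x p ;
  gcomp_posdef : forall x p (v : 'rV[R]_n), coordinates S x -> cdom x p ->
    v != 0 -> 0 < (v *m gcomp x p *m v^T) 0 0 ;
  gcomp_continuous : forall x p a b, coordinates S x -> cdom x p ->
    {for p, continuous (fun q => gcomp x q a b)} ;
  gcomp_change : forall x y p, coordinates S x -> coordinates S y ->
    cdom x p -> cdom y p ->
    gcomp x p = jacobian_mx x y p *m gcomp y p *m (jacobian_mx x y p)^T
}.

(** * Coordinate expressions of the scalar curvature, Laplacian and L_g *)

Section CoordinateExpressions.
Variables (R : realType) (n : nat) (G : 'rV[R]_n -> 'M[R]_n).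

Definition ginv (a b : 'I_n) : 'rV[R]_n -> R := fun z => invmx (G z) a b.

Definition christoffel (k i j : 'I_n) : 'rV[R]_n -> R := fun z =>
  2^-1 * \sum_l ginv k l z *
    (partial i (fun w => G w j l) z + partial j (fun w => G w i l) z
     - partial l (fun w => G w i j) z).

Definition ricci (i j : 'I_n) : 'rV[R]_n -> R := fun z =>
  \sum_k (partial k (christoffel k i j) z - partial j (christoffel k i k) z
    + \sum_l (christoffel k k l z * christoffel l i j z
              - christoffel k j l z * christoffel l i k z)).

(** Signs are such that round spheres have positive scalar curvature. *)
Definition scalar_curvature : 'rV[R]_n -> R := fun z =>
  \sum_i \sum_j ginv i j z * ricci i j z.

Definition sqrt_det : 'rV[R]_n -> R := fun z => Num.sqrt (\det (G z)).

Definition laplacian (u : 'rV[R]_n -> R) : 'rV[R]_n -> R := fun z =>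
  - ((sqrt_det z)^-1 *
     \sum_a partial a
       (fun w => sqrt_det w * \sum_b ginv a b w * partial b u w) z).

Definition conformal_laplacian (u : 'rV[R]_n -> R) : 'rV[R]_n -> R := fun z =>
  laplacian u z + (n%:R - 2) / (4 * (n%:R - 1)) * scalar_curvature z * u z.

End CoordinateExpressions.

(** The function [L_g u] on [cdom x], by the coordinate formulas above with
    [g_ab] and [d_a] taken in the coordinates [x].  [L_g] is invariant under
    C^3 changes of coordinates, so any coordinates of [S] covering the domain
    of [u] may be used; the same applies to [C2_in]. *)
Definition conformal_laplacian_in (R : realType) (n : nat)
    (M : topologicalType) (S : smooth_structure R n M)
    (g : riemannian_metric S) (x : coord_system R n M) (u : M -> R) : M -> R :=
  fun p => conformal_laplacian (fun z => gcomp g x (coord_inv x z))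
                               (u \o coord_inv x) (coord x p).

Definition C2_in (R : realType) (n : nat) (M : topologicalType)
    (x : coord_system R n M) (u : M -> R) : Prop :=
  class_Ck 2 (crange x) (u \o coord_inv x).

(** * Isothermal coordinates and conformal harmonic coordinates *)

Definition isothermal (R : realType) (n : nat) (M : topologicalType)
    (S : smooth_structure R n M) (g : riemannian_metric S) (r : R)
    (x : coord_system R n M) : Prop :=
  exists c : 'rV[R]_n -> R,
    [/\ forall z, crange x z -> 0 < c z,
        class_Cr r (crange x) c &
        forall p, cdom x p -> gcomp g x p = (c (coord x p))%:M].

Definition conformal_harmonic (R : realType) (n : nat) (M : topologicalType)
    (S : smooth_structure R n M) (g : riemannian_metric S)
    (Z : coord_system R n M) : Prop :=
  coordinates S Z /\
  exists (F : 'I_n -> M -> R) (f : M -> R),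
    [/\ (forall k, C2_in Z (F k)) /\ C2_in Z f,
        forall p, cdom Z p -> 0 < f p,
        forall k p, cdom Z p -> conformal_laplacian_in g Z (F k) p = 0,
        forall p, cdom Z p -> conformal_laplacian_in g Z f p = 0 &
        forall k p, cdom Z p -> coord Z p 0 k = F k p / f p].

(* Main.v *)
Require Import Defs.
From mathcomp Require Import all_boot all_order all_algebra.
From mathcomp Require Import all_classical all_reals all_analysis.
From mathcomp Require Import ring.

Set Implicit Arguments.
Unset Strict Implicit.
Unset Printing Implicit Defensive.

Import Order.TTheory GRing.Theory Num.Theory.
Import numFieldNormedType.Exports.
Local Open Scope classical_set_scope.
Local Open Scope ring_scope.

(** Why isothermal coordinates are conformal harmonic.

    Write the conformal factor as [c = e^(2 phi)] and put [m = (n - 2) / 2].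
    The conformal Laplacian is conformally covariant: comparing the metric
    [e^(2 phi) delta] with the flat one,
      [L_g (e^(- m phi) u) = - e^(- (m + 2) phi) * sum_a d_a d_a u]
    for every [u] of class C^2 ([conformal_laplacian_covariant]).  The constant
    function [1] and the coordinate functions [x^k] are harmonic for the flat
    Laplacian, so [f = e^(- m phi)] and [f^k = x^k e^(- m phi)] are annihilated
    by [L_g]; moreover [f > 0] and [f^k / f = x^k].

    The covariance is a direct computation.  On the one hand, the flux
    [sqrt(det g) g^(ab) d_b (e^(- m phi) u)] is
    [e^(m phi) (d_a u - m u d_a phi)], whose divergence no longer contains
    first derivatives of [u], but has a zeroth order term
    [- u (m sum_a d_a d_a phi + m^2 sum_a (d_a phi)^2)].  On the other hand,
    the scalar curvature of [e^(2 phi) delta] is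
      [- e^(- 2 phi) (n - 1)
           (2 sum_k d_k d_k phi + (n - 2) sum_k (d_k phi)^2)]
    ([scalar_curvatureE]), and multiplied by [(n - 2) / (4 (n - 1))] it cancels
    precisely that zeroth order term.

    As the coordinate expressions agree with the formulas in [phi] on the range
    of the coordinates only, everything is computed on an open set [V], using that
    derivatives are local. *)

(** * Directional derivatives and locality *)

(** The chain rule for an outer function of one variable: along the line
    [t |-> t v + z] everything is a function of [t]. *)
Lemma is_derive_scalar_comp (R : realType) (W : normedModType R) (f : W -> R)
    (h : R -> R) (z v : W) (df dh : R) :
  is_derive (f z) 1 h dh -> is_derive z v f df ->
  is_derive z v (h \o f) (dh * df).
Proof.
have D1 (u : W -> R) : 'D_v u z = 'D_1 (fun t : R => u (t *: v + z)) 0.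
  rewrite /derive; set q1 := fun t => t^-1 *: _; set q2 := fun t => t^-1 *: _.
  suff -> : q1 = q2 by [].
  apply/funext => t; rewrite /q1 /q2 /=.
  by rewrite addr0 scale0r add0r [_%:A]mulr1.
move=> dhf [/derivable1P fz dfz].
have dl : is_derive (0 : R) 1 (fun t : R => f (t *: v + z)) df.
  by rewrite -dfz D1; apply: DeriveDef.
have dhf' : is_derive (f (0 *: v + z)) 1 h dh by rewrite scale0r add0r.
have [dhl ehl] := is_derive1_comp dhf' dl.
by apply: DeriveDef; [exact/derivable1P | rewrite D1].
Qed.

Lemma is_derive_entry (R : realType) m n (M v : 'M[R]_(m, n)) i j :
  is_derive M v (fun N : 'M[R]_(m, n) => N i j) (v i j).
Proof.
have dM := @derivable_id R _ M v.
apply: DeriveDef; first exact: (derivable_mxP _ _ _).1 dM i j.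
have := derive_mx dM; rewrite derive_id => /matrixP/(_ i j).
by rewrite mxE.
Qed.

Lemma open_near_eq {T : topologicalType} {U : Type} {V : set T} {f g : T -> U}
    {z : T} :
  open V -> {in V, f =1 g} -> V z -> \near z, f z = g z.
Proof.
move=> oV fg Vz; near=> w; apply: fg; rewrite inE; near: w.
exact: open_nbhs_nbhs.
Unshelve. all: by end_near. Qed.

Lemma open_eq_continuous {T U : topologicalType} {V : set T} {f g : T -> U}
    {z : T} :
  open V -> {in V, f =1 g} -> V z -> {for z, continuous f} ->
  {for z, continuous g}.
Proof.
move=> oV fg Vz cf; rewrite /prop_for /continuous_at -(fg z (mem_set Vz)).
apply: cvg_trans cf; apply: near_eq_cvg; exact: open_near_eq oV fg Vz.
Qed.

(** * Stability properties of the class C^k *)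

Section Ck.
Variables (R : realType) (n : nat).
Implicit Types (V : set 'rV[R]_n) (f g : 'rV[R]_n -> R).

Lemma partial_near {V f g i} : open V -> {in V, f =1 g} ->
  {in V, partial i f =1 partial i g}.
Proof.
by move=> oV fg z /[!inE] Vz; apply/near_eq_derive/(open_near_eq oV fg).
Qed.

(** The recursive description of C^k on which the inductions below rest: the
    innermost derivative of an iterated one can be split off. *)
Lemma class_CkS k V f : class_Ck k.+1 V f <->
  [/\ forall z, V z -> {for z, continuous f},
      forall i z, V z -> derivable f z (delta_mx 0 i) &
      forall i, class_Ck k V (partial i f)].
Proof.
have rc s i : partials s (partial i f) = partials (rcons s i) f.
  by rewrite /partials foldr_rcons.
split=> [[df cf]|[cf df pf]].
  split=> [z Vz|i z Vz|i]; [exact: (cf [::])|exact: (df [::])|split].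
  - by move=> s j z sk Vz; rewrite rc; apply: df; rewrite ?size_rcons.
  - by move=> s z sk Vz; rewrite rc; apply: cf; rewrite ?size_rcons.
split=> [s i z|s z]; case/lastP: s => [|s j]; rewrite ?size_rcons.
- by move=> _; exact: df.
- by move=> sk Vz; rewrite -rc; apply: (pf j).1.
- by move=> _; exact: cf.
- by move=> sk Vz; rewrite -rc; apply: (pf j).2.
Qed.

Lemma class_C0 V f : (forall z, V z -> {for z, continuous f}) -> class_Ck 0 V f.
Proof. by move=> cf; split=> // -[|//] z _; exact: cf. Qed.

Lemma class_Ck_continuous k V f z : class_Ck k V f -> V z ->
  {for z, continuous f}.
Proof. by case=> _ /(_ [::]) + Vz; apply. Qed.

Lemma class_Ck_leq k l V f : (k <= l)%N -> class_Ck l V f -> class_Ck k V f.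
Proof.
move=> kl [df cf]; split=> [s i z sk|s z sk].
  by apply: df; exact: leq_trans kl.
by apply: cf; exact: leq_trans kl.
Qed.

Lemma class_Ck_eq k V f g : open V -> {in V, f =1 g} -> class_Ck k V f ->
  class_Ck k V g.
Proof.
move=> oV fg [df cf].
have fgs s : {in V, partials s f =1 partials s g}.
  by elim: s => [|i s IHs] //=; exact: partial_near.
split=> [s i z sk Vz|s z sk Vz].
  by apply: near_eq_derivable (df s i z sk Vz); exact: (open_near_eq oV).
exact: open_eq_continuous oV (fgs s) Vz (cf s z sk Vz).
Qed.

Lemma class_Ck_partial {k V f i z} : class_Ck k.+1 V f -> V z ->
  is_derive z (delta_mx 0 i) f (partial i f z).
Proof. by move=> /class_CkS[_ df _] Vz; apply: derivableP; exact: df. Qed.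

(** For exhibiting functions of class C^(k+1): the candidate derivatives need
    to be correct on [V] only. *)
Lemma class_CkS_intro k V f (f' : 'I_n -> 'rV[R]_n -> R) : open V ->
  (forall z, V z -> {for z, continuous f}) ->
  (forall i z, V z -> is_derive z (delta_mx 0 i) f (f' i z)) ->
  (forall i, class_Ck k V (f' i)) -> class_Ck k.+1 V f.
Proof.
move=> oV cf df f'k; apply/class_CkS; split=> // i => [z Vz|].
  by have [] := df i z Vz.
apply: (class_Ck_eq (f := f' i)) => // z /[!inE] Vz.
by have [_ <-] := df i z Vz.
Qed.

Lemma class_CkD k V f g : open V -> class_Ck k V f -> class_Ck k V g ->
  class_Ck k V (f \+ g).
Proof.
move=> oV; elim: k f g => [|k IHk] f g fk gk.
  apply: class_C0 => z Vz.
  by apply: continuousD; [exact: class_Ck_continuous fk Vz|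
    exact: class_Ck_continuous gk Vz].
apply: (class_CkS_intro (f' := (fun i => partial i f \+ partial i g))) => //.
- move=> z Vz.
  by apply: continuousD; [exact: class_Ck_continuous fk Vz|
    exact: class_Ck_continuous gk Vz].
- by move=> i z Vz; apply: is_deriveD; [exact: class_Ck_partial fk Vz|
    exact: class_Ck_partial gk Vz].
- move: fk gk => /class_CkS[_ _ fk] /class_CkS[_ _ gk] i.
  exact: IHk.
Qed.

Lemma class_CkM k V f g : open V -> class_Ck k V f -> class_Ck k V g ->
  class_Ck k V (f \* g).
Proof.
move=> oV; elim: k f g => [|k IHk] f g fk gk.
  apply: class_C0 => z Vz.
  by apply: continuousM; [exact: class_Ck_continuous fk Vz|
    exact: class_Ck_continuous gk Vz].
apply: (class_CkS_intro (f' :=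
  (fun i => (f \* partial i g) \+ (g \* partial i f)))) => //.
- move=> z Vz.
  by apply: continuousM; [exact: class_Ck_continuous fk Vz|
    exact: class_Ck_continuous gk Vz].
- by move=> i z Vz; apply: is_deriveM; [exact: class_Ck_partial fk Vz|
    exact: class_Ck_partial gk Vz].
- have fk' := class_Ck_leq (leqnSn k) fk.
  have gk' := class_Ck_leq (leqnSn k) gk.
  move: fk gk => /class_CkS[_ _ fk] /class_CkS[_ _ gk] i.
  by apply: class_CkD => //; exact: IHk.
Qed.

Lemma class_Ck_cst k V (a : R) : open V -> class_Ck k V (fun=> a).
Proof.
move=> oV; elim: k a => [|k IHk] a.
  by apply: class_C0 => z _; exact: cst_continuous.
apply: (class_CkS_intro (f' := (fun _ _ => 0))) => // z _.
exact: cst_continuous.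
Qed.

Lemma class_Ck_coord k V i : open V -> class_Ck k V (fun z => z 0 i).
Proof.
move=> oV; case: k => [|k].
  by apply: class_C0 => z _; exact: coord_continuous.
apply: (class_CkS_intro
  (f' := (fun j _ => (delta_mx 0 j : 'rV[R]_n) 0 i))) => //.
- by move=> z _; exact: coord_continuous.
- by move=> j z _; exact: is_derive_entry.
- by move=> j; exact: class_Ck_cst.
Qed.

Lemma class_Ck_expR k V f : open V -> class_Ck k V f ->
  class_Ck k V (expR \o f).
Proof.
move=> oV; elim: k => [|k IHk] fk;
  have cf z (Vz : V z) : {for z, continuous (expR \o f)}
    by apply: continuous_comp;
      [exact: class_Ck_continuous fk Vz|exact: continuous_expR].
  exact: class_C0.
apply: (class_CkS_intro (f' := (fun i => (expR \o f) \* partial i f))) => //.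
- move=> i z Vz; apply: is_derive_scalar_comp; exact: class_Ck_partial fk Vz.
- move=> i; apply: class_CkM => //; first exact/IHk/class_Ck_leq/fk.
  by move: fk => /class_CkS[].
Qed.

(** By induction on [k]: the derivatives [(d_i f) / f] involve [1 / f], which is
    [expR (- ln f)] and hence C^k as soon as [ln f] is. *)
Lemma class_Ck_ln k V f : open V -> (forall z, V z -> 0 < f z) ->
  class_Ck k V f -> class_Ck k V (@ln R \o f).
Proof.
move=> oV f0; elim: k => [|k IHk] fk;
  have cf z (Vz : V z) : {for z, continuous (@ln R \o f)}
    by apply: continuous_comp;
      [exact: class_Ck_continuous fk Vz|exact/continuous_ln/f0].
  exact: class_C0.
apply: (class_CkS_intro (f' := (fun i z => (f z)^-1 * partial i f z))) => //.
- move=> i z Vz; apply: is_derive_scalar_comp;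
    last exact: class_Ck_partial fk Vz.
  exact/is_derive1_ln/f0.
- move=> i; have lnk := IHk (class_Ck_leq (leqnSn k) fk).
  apply: class_CkM => //; last by move: fk => /class_CkS[].
  apply: (class_Ck_eq (f := expR \o ((fun=> -1) \* (@ln R \o f)))) => //.
    move=> z /[!inE] Vz /=.
    by rewrite mulN1r expRN lnK // posrE f0.
  apply: class_Ck_expR => //; apply: class_CkM => //; exact: class_Ck_cst.
Qed.

End Ck.

(** * Algebra of the curvature of a conformally flat metric *)

Lemma partialE (R : realType) n (f : 'rV[R]_n -> R) i z df :
  is_derive z (delta_mx 0 i) f df -> partial i f z = df.
Proof. by case. Qed.

Lemma sum_delta (R : pzSemiRingType) n (i : 'I_n) (F : 'I_n -> R) :
  \sum_j (i == j)%:R * F j = F i.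
Proof.
rewrite (bigD1 i) //= eqxx mul1r big1 ?addr0 // => j ji.
by rewrite eq_sym (negPf ji) mul0r.
Qed.

Lemma sum_ord_const (R : pzSemiRingType) n (a : R) : \sum_(i < n) a = n%:R * a.
Proof. by rewrite sumr_const card_ord mulr_natl. Qed.

(** With [p] the gradient of [phi] at a point, [Gam k i j] is the Christoffel
    symbol of [e^(2 phi) delta] with upper index [k]; the sum is the quadratic
    part of the diagonal Ricci coefficient. *)
Lemma sum_conformal_christoffel (R : comPzRingType) n (p : 'I_n -> R)
    (i : 'I_n) :
  let Gam k i j := (j == k)%:R * p i + (i == k)%:R * p j - (i == j)%:R * p k in
  \sum_k \sum_l (Gam k k l * Gam l i i - Gam k i l * Gam l i k) =
  (n%:R - 2) * (p i ^+ 2 - \sum_k p k ^+ 2).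
Proof.
move=> Gam; set N := \sum_k p k ^+ 2.
have inner k : \sum_l (Gam k k l * Gam l i i - Gam k i l * Gam l i k) =
    p i ^+ 2 - N + (i == k)%:R * (N - 2 * p k * p i) + p k ^+ 2.
  rewrite (eq_bigr (fun l => (i == l)%:R * (2 * p l * p i + p k ^+ 2
      - 2 * (i == k)%:R * p k * p l) + (k == l)%:R * - p i ^+ 2
      + ((i == k)%:R - 1) * p l ^+ 2)).
    by rewrite !big_split /= !sum_delta -mulr_sumr -/N; ring.
  move=> l _; rewrite /Gam !eqxx [l == k]eq_sym.
  by case: (eqVneq i k) (eqVneq i l) (eqVneq k l) => [?|?] [?|?] [?|?] /=;
    subst; rewrite ?eqxx /=; try ring; try congruence.
under eq_bigr do rewrite inner.
rewrite !big_split /= sum_delta -/N !sum_ord_const; ring.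
Qed.

(** With moreover [q] the matrix of second derivatives of [phi], [dGam m] is the
    derivative of [Gam] in direction [m], and the sum is the diagonal Ricci
    coefficient. *)
Lemma sum_conformal_ricci (R : comPzRingType) n (p : 'I_n -> R)
    (q : 'I_n -> 'I_n -> R) (i : 'I_n) :
  let Gam k i j := (j == k)%:R * p i + (i == k)%:R * p j - (i == j)%:R * p k in
  let dGam m k i j :=
    (j == k)%:R * q i m + (i == k)%:R * q j m - (i == j)%:R * q k m in
  \sum_k (dGam k k i i - dGam i k i k
    + \sum_l (Gam k k l * Gam l i i - Gam k i l * Gam l i k)) =
  (2 - n%:R) * q i i - \sum_k q k k
    + (n%:R - 2) * (p i ^+ 2 - \sum_k p k ^+ 2).
Proof.
move=> Gam dGam; rewrite big_split /= sum_conformal_christoffel; congr (_ + _).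
rewrite (eq_bigr (fun k => (i == k)%:R * (2 * q i k) + - q k k - q i i)).
  by rewrite !big_split /= sum_delta !sumrN !sum_ord_const; ring.
by move=> k _; rewrite /dGam !eqxx /=; ring.
Qed.

(** The flat trace of the Ricci tensor, [q] being now the diagonal of the matrix
    of second derivatives of [phi]. *)
Lemma sum_conformal_ricci_diag (R : comPzRingType) n (p q : 'I_n -> R) :
  \sum_i ((2 - n%:R) * q i - \sum_k q k
    + (n%:R - 2) * (p i ^+ 2 - \sum_k p k ^+ 2)) =
  - (n%:R - 1) * (2 * \sum_k q k + (n%:R - 2) * \sum_k p k ^+ 2).
Proof.
by rewrite !big_split /= -!mulr_sumr !big_split /= !sumrN !sum_ord_const; ring.
Qed.

(** * Conformal covariance of the conformal Laplacian *)

Lemma partial_cst (R : realType) n (i : 'I_n) (a : R) :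
  partial i (fun=> a) = fun=> 0.
Proof. by apply/funext => z; exact: partialE. Qed.

Lemma partial_coord (R : realType) n (i k : 'I_n) :
  partial i (fun z : 'rV[R]_n => z 0 k) = fun=> (delta_mx 0 i : 'rV[R]_n) 0 k.
Proof. by apply/funext => z; exact/partialE/is_derive_entry. Qed.

Section ConformallyFlat.
Variables (R : realType) (n : nat) (V : set 'rV[R]_n) (phi : 'rV[R]_n -> R)
  (G : 'rV[R]_n -> 'M[R]_n).
Hypotheses (oV : open V) (phi2 : class_Ck 2 V phi)
  (GE : {in V, forall z, G z = (expR (2 * phi z))%:M}).
Implicit Types z : 'rV[R]_n.

Local Notation p i := (partial i phi).
Local Notation q i j := (partial j (partial i phi)).

Lemma is_derive_p i j z : V z -> is_derive z (delta_mx 0 j) (p i) (q i j z).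
Proof.
move=> Vz; move: phi2 => /class_CkS[_ _ /(_ i) pi].
exact: class_Ck_partial pi Vz.
Qed.

Lemma is_derive_expR_phi a i z : V z ->
  is_derive z (delta_mx 0 i) (fun w => expR (a * phi w))
    (expR (a * phi z) * (a * p i z)).
Proof.
move=> Vz; apply: (is_derive_scalar_comp (h := @expR R)).
exact/is_deriveZ/(class_Ck_partial phi2).
Qed.

Lemma ginvE a b z : V z -> ginv G a b z = (a == b)%:R * expR (- 2 * phi z).
Proof.
move=> Vz; rewrite /ginv GE ?inE // invmx_scalar mxE -expRN mulNr.
by rewrite [RHS]mulr_natl.
Qed.

Lemma christoffelE k i j z : V z ->
  christoffel G k i j z =
  (j == k)%:R * p i z + (i == k)%:R * p j z - (i == j)%:R * p k z.
Proof.
move=> Vz.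
have dG a b c : partial a (fun w => G w b c) z =
    (b == c)%:R * (expR (2 * phi z) * (2 * p a z)).
  rewrite (partial_near oV
    (g := fun w => (b == c)%:R * expR (2 * phi w))) ?inE //.
    by apply/partialE/is_deriveZ/is_derive_expR_phi.
  by move=> w wV; rewrite GE // mxE [RHS]mulr_natl.
rewrite /christoffel; under eq_bigr do rewrite ginvE // -mulrA !dG.
rewrite sum_delta mulNr expRN.
have alg (e a b c x y w : R) : e != 0 ->
    2^-1 * (e^-1 *
      (x * (e * (2 * a)) + y * (e * (2 * b)) - w * (e * (2 * c)))) =
    x * a + y * b - w * c by move=> e0; field.
by apply: alg; rewrite gt_eqF ?expR_gt0.
Qed.

Lemma partial_christoffelE m k i j z : V z ->
  partial m (christoffel G k i j) z =
  (j == k)%:R * q i m z + (i == k)%:R * q j m z - (i == j)%:R * q k m z.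
Proof.
move=> Vz; rewrite (partial_near oV (g := fun w =>
  (j == k)%:R * p i w + (i == k)%:R * p j w - (i == j)%:R * p k w)) ?inE //.
  apply: partialE; apply: is_deriveB.
    by apply: is_deriveD; exact/is_deriveZ/is_derive_p.
  exact/is_deriveZ/is_derive_p.
by move=> w /[!inE] Vw; rewrite christoffelE.
Qed.

Lemma ricci_diagE i z : V z ->
  ricci G i i z = (2 - n%:R) * q i i z - \sum_k q k k z
    + (n%:R - 2) * (p i z ^+ 2 - \sum_k p k z ^+ 2).
Proof.
move=> Vz; rewrite -(sum_conformal_ricci (fun k => p k z) (fun i j => q i j z)).
apply: eq_bigr => k _; rewrite !partial_christoffelE //; congr (_ + _).
by apply: eq_bigr => l _; rewrite !christoffelE.
Qed.

Lemma scalar_curvatureE z : V z ->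
  scalar_curvature G z = - expR (- 2 * phi z) * (n%:R - 1) *
    (2 * \sum_k q k k z + (n%:R - 2) * \sum_k p k z ^+ 2).
Proof.
move=> Vz; rewrite /scalar_curvature.
under eq_bigr => i _.
  under eq_bigr do rewrite ginvE // -mulrA.
  rewrite sum_delta ricci_diagE //; over.
rewrite -mulr_sumr.
rewrite (sum_conformal_ricci_diag (fun k => p k z) (fun k => q k k z)).
by rewrite mulNr mulrA !mulrN !mulNr.
Qed.

Lemma sqrt_detE z : V z -> sqrt_det G z = expR (n%:R * phi z).
Proof.
move=> Vz; rewrite /sqrt_det GE ?inE // det_scalar -expRM_natl mulrCA.
by rewrite (expRM_natl 2) sqrtr_sqr ger0_norm ?expR_ge0.
Qed.

(** The weight [- m] makes the first order terms cancel in the divergence, and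
    then the curvature term of [L_g] removes the term of order zero. *)
Lemma conformal_laplacian_covariant (u U : 'rV[R]_n -> R) z :
  n != 1 -> let m := (n%:R - 2) / 2 in
  class_Ck 2 V u -> {in V, forall w, U w = expR (- m * phi w) * u w} -> V z ->
  conformal_laplacian G U z =
  - expR (- (m + 2) * phi z) * \sum_a partial a (partial a u) z.
Proof.
move=> n1 m u2 UE Vz.
have dU a w : V w ->
    partial a U w = expR (- m * phi w) * (partial a u w - m * p a w * u w).
  move=> Vw; rewrite (partial_near oV UE) ?inE //; apply: partialE.
  apply: is_derive_eq; first by apply: is_deriveM;
    [exact: is_derive_expR_phi|exact: class_Ck_partial u2 Vw].
  rewrite /GRing.scale /=; move: (partial a u w) (p a w) => ua pa; ring.
pose W a w := expR (m * phi w) * (partial a u w - m * p a w * u w).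
(* The flux: [e^(n phi) e^(- 2 phi) = e^(2 m phi)], times the factor
   [e^(- m phi)] of [U]. *)
have fluxE a : {in V, (fun w =>
    sqrt_det G w * \sum_b ginv G a b w * partial b U w) =1 W a}.
  move=> w /[!inE] Vw; under eq_bigr do rewrite ginvE // -mulrA.
  rewrite sum_delta sqrt_detE // dU // /W !mulrA -!expRD.
  by congr (expR _ * _); rewrite /m; field.
have dW a : partial a (W a) z = expR (m * phi z) *
    (partial a (partial a u) z - u z * (m * q a a z + m ^+ 2 * p a z ^+ 2)).
  apply: partialE; apply: is_derive_eq.
    apply: is_deriveM; first exact: is_derive_expR_phi.
    apply: is_deriveB.
      by move: u2 => /class_CkS[_ _ /(_ a) ua]; exact: class_Ck_partial ua Vz.
    apply: is_deriveM; last exact: class_Ck_partial u2 Vz.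
    exact/is_deriveZ/is_derive_p.
  rewrite /GRing.scale /=.
  move: (q a a z) (p a z) (partial a u z) (partial a (partial a u) z).
  move=> qa pa ua uaa.
  ring.
have sumE (a b c : 'I_n -> R) v :
    \sum_i (a i - v * (m * b i + m ^+ 2 * c i ^+ 2)) =
    \sum_i a i - v * (m * \sum_i b i + m ^+ 2 * \sum_i c i ^+ 2).
  by rewrite !(mulr_sumr, =^~ big_split, =^~ sumrB).
(* [e], [E] and [k] stand for [e^(- n phi)], [e^(m phi)] and [e^(- 2 phi)];
   this is the cancellation of the zeroth order terms. *)
have closeE (A B C v e E k : R) : k != 0 ->
    - (e * (E * (A - v * (m * B + m ^+ 2 * C))))
    + (n%:R - 2) / (4 * (n%:R - 1)) *
      (- k * (n%:R - 1) * (2 * B + (n%:R - 2) * C)) * (e * E / k * v)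
    = - (e * E) * A.
  by move=> k0; rewrite /m; field; rewrite k0 subr_eq0 (eqr_nat _ n 1) n1.
rewrite /conformal_laplacian /laplacian.
under eq_bigr do rewrite (partial_near oV (fluxE _)) ?inE // dW.
rewrite -mulr_sumr (sumE _ (fun a => q a a z) (fun a => p a z)).
rewrite sqrt_detE // scalar_curvatureE // UE ?inE // -expRN.
have -> : expR (- (m + 2) * phi z) = expR (- (n%:R * phi z)) * expR (m * phi z).
  by rewrite -expRD; congr expR; rewrite /m; field.
have -> : expR (- m * phi z) =
    expR (- (n%:R * phi z)) * expR (m * phi z) / expR (- 2 * phi z).
  by rewrite -expRN -!expRD; congr expR; rewrite /m; field.
by apply: closeE; rewrite gt_eqF ?expR_gt0.
Qed.

End ConformallyFlat.

(** * Isothermal coordinates *)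

Theorem proposition2p8 (R : realType) (n : nat) (hn : (3 <= n)%N)
    (M : topologicalType) (S : smooth_structure R n M)
    (g : riemannian_metric S) (x : coord_system R n M)
    (hx : coordinates S x) (r : R) (hr : 2 < r) (hiso : isothermal g r x) :
  conformal_harmonic g x.
Proof.
case: hiso => c [c0 [cr _] gc].
have oV : open (crange x) := @crange_open _ _ _ x.
have coord_invK z : crange x z ->
    cdom x (coord_inv x z) /\ Defs.coord x (coord_inv x z) = z.
  by case=> p xp <-; rewrite coordK.
have c2 : class_Ck 2 (crange x) c.
  by apply: class_Ck_leq cr; rewrite truncn_ge_nat ltW // (lt_trans _ hr).
pose phi := (fun=> 2^-1) \* (@ln R \o c) : 'rV[R]_n -> R.
have phi2 : class_Ck 2 (crange x) phi.
  by apply: class_CkM => //; [exact: class_Ck_cst|exact: class_Ck_ln].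
have gE : {in crange x, forall z,
    gcomp g x (coord_inv x z) = (expR (2 * phi z))%:M}.
  move=> z /[!inE] xz; have [xp pz] := coord_invK z xz.
  by rewrite gc // pz /phi /= mulVKf // lnK // posrE c0.
pose m : R := (n%:R - 2) / 2.
pose h z := expR (- m * phi z).
have h2 : class_Ck 2 (crange x) h.
  apply: (class_Ck_expR (f := (fun=> - m) \* phi)) => //.
  by apply: class_CkM => //; exact: class_Ck_cst.
have harmonic u : class_Ck 2 (crange x) u ->
    (forall a z, partial a (partial a u) z = 0) ->
    let F p := u (Defs.coord x p) * h (Defs.coord x p) in
    C2_in x F /\ forall p, cdom x p -> conformal_laplacian_in g x F p = 0.
  move=> u2 u0 F.
  have FE : {in crange x, u \* h =1 F \o coord_inv x}.
    by move=> z /[!inE] /coord_invK[_ pz]; rewrite /F /= pz.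
  split=> [|p xp].
    apply: (class_Ck_eq _ FE) => //; exact: class_CkM.
  rewrite /conformal_laplacian_in.
  rewrite (conformal_laplacian_covariant oV phi2 gE _ u2); last first.
  - by exists p.
  - by move=> z xz; rewrite -FE // mulrC.
  - by apply: contraTneq hn => ->.
  - by rewrite big1 ?mulr0.
have c1 := harmonic (fun=> 1) (class_Ck_cst 2 1 oV).
have ck k := harmonic (fun z => z 0 k) (class_Ck_coord 2 k oV).
split=> //.
exists (fun k p => Defs.coord x p 0 k * h (Defs.coord x p)),
  (fun p => 1 * h (Defs.coord x p)).
split=> [|p xp|k|//|k p xp].
- split=> [k|]; [apply: (ck k _).1 | apply: (c1 _).1] => a z.
    by rewrite partial_coord partial_cst.
  by rewrite !partial_cst.
- by rewrite mul1r expR_gt0.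
- by apply: (ck k _).2 => a z; rewrite partial_coord partial_cst.
- by apply: (c1 _).2 => a z; rewrite !partial_cst.
- by rewrite mul1r mulfK // gt_eqF ?expR_gt0.
Qed.
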